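(* Let $\lambda\in\mathbb{R}$ and let $r\ge 0$ be an integer. For all integers $m,k$ with $k\ge m\ge 0$, $$(-1)^{k-m+1}{k+r+1 \brack m+r}_{r,\lambda}=\sum_{l=m-1}^{k}{k+r \brack l+r}_{r,\lambda}(-1)^{k-m+1}\binom{l}{m-1}\langle 1\rangle_{l-m+1,\lambda}+(m\lambda-r)\sum_{l=m}^{k}{k+r \brack l+r}_{r,\lambda}(-1)^{k-m}\binom{l}{m}\langle 1\rangle_{l-m,\lambda}.$$
   Context: For $\lambda\in\mathbb{R}$ and $y$ a number or indeterminate, $\langle y\rangle_{0}=1$, $\langle y\rangle_{n}=y(y+1)\cdots(y+n-1)$ for $n\ge1$, and $\langle y\rangle_{0,\lambda}=1$, $\langle y\rangle_{n,\lambda}=y(y+\lambda)\cdots(y+(n-1)\lambda)$ for $n\ge 1$. For an integer $r\ge 0$, the unsigned degenerate $r$-Stirling numbers of the first kind ${n+r \brack k+r}_{r,\lambda}$ ($0\le k\le n$) are defined by the polynomial identity $$\langle y+r\rangle_{n}=\sum_{k=0}^{n}{n+r \brack k+r}_{r,\lambda}\langle y\rangle_{k,\lambda}\quad (n\ge 0).$$ Conventions: ${n+r\brack k+r}_{r,\lambda}=0$ if $k<0$ or $k>n$, and $\binom{l}{m-1}=0$ if $m=0$. In particular the first sum is $0$ when $m=0$. *)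

(* Defs.v *)
From HB Require Import structures.
From mathcomp Require Import all_boot all_order all_algebra.
From mathcomp Require Import boolp reals.

Set Implicit Arguments.
Unset Strict Implicit.
Unset Printing Implicit Defensive.

Import GRing.Theory.
Local Open Scope ring_scope.

(* The base ring A is arbitrary so that y may be a number (A := R) as well as
   an indeterminate (A := {poly R}, y := 'X). *)
Definition rising (A : comNzRingType) (y : A) (n : nat) : A :=
  \prod_(i < n) (y + i%:R).

Definition degenerate_rising (A : comNzRingType) (lam y : A) (n : nat) : A :=
  \prod_(i < n) (y + lam *+ i).

(* [S n k] stands for the coefficient with upper index n + r and lower index
   k + r. *)
Definition is_rStirling1 (R : comNzRingType) (lam : R) (r : nat)
    (S : nat -> nat -> R) : Prop :=
  (forall n : nat,
     rising ('X + r%:R) n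
       = \sum_(k < n.+1) S n k *: degenerate_rising lam%:P 'X k)
  /\ (forall n k : nat, (n < k)%N -> S n k = 0).

Lemma rStirling1_exists (R : comNzRingType) (lam : R) (r : nat) :
  exists S : nat -> nat -> R, is_rStirling1 lam r S.
Proof.
pose step n (u : nat -> R) k :=
  (if k is k'.+1 then u k' else 0) + ((n + r)%:R - lam *+ k) * u k.
pose S := fix S n : nat -> R := if n is n'.+1 then step n' (S n')
                     else fun k : nat => (k == 0%N)%:R : R.
have S0 n k : (n < k)%N -> S n k = 0.
  elim: n k => [|n IHn] [|k] //= ltnk.
  by rewrite /step !IHn ?mulr0 ?addr0 // ltnW.
exists S; split=> // n; elim: n => [|n IHn].
  by rewrite /rising /degenerate_rising big_ord1 !big_ord0 /= scale1r.
have degS k : degenerate_rising lam%:P 'X k.+1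
    = degenerate_rising lam%:P 'X k * ('X + lam%:P *+ k).
  by rewrite /degenerate_rising big_ord_recr.
have E k : degenerate_rising lam%:P 'X k * ('X + r%:R + n%:R)
    = degenerate_rising lam%:P 'X k.+1
      + ((n + r)%:R - lam *+ k) *: degenerate_rising lam%:P 'X k.
  rewrite degS -[in RHS]mul_polyC mulrC [_%:P * _]mulrC -mulrDr mulrC.
  congr (_ * _); rewrite raddfB /= polyC_natr polyCMn natrD.
  by rewrite addrACA addrN addr0 addrA addrAC.
have E' a k : a *: degenerate_rising lam%:P 'X k * ('X + r%:R + n%:R)
    = a *: degenerate_rising lam%:P 'X k.+1
      + (((n + r)%:R - lam *+ k) * a) *: degenerate_rising lam%:P 'X k.
  by rewrite -scalerAl E scalerDr scalerA [a * _]mulrC.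
rewrite /rising big_ord_recr /= -/(rising _ n) IHn mulr_suml.
transitivity (\sum_(k < n.+1) (S n k *: degenerate_rising lam%:P 'X k.+1
    + (((n + r)%:R - lam *+ k) * S n k) *: degenerate_rising lam%:P 'X k)).
  by apply: eq_bigr => k _; exact: E'.
rewrite big_split /=.
rewrite [RHS](_ : _ = \sum_(k < n.+2) (if (k : nat) is k'.+1 then S n k' else 0)
    *: degenerate_rising lam%:P 'X k
  + \sum_(k < n.+2) (((n + r)%:R - lam *+ k) * S n k)
    *: degenerate_rising lam%:P 'X k); last first.
  by rewrite -big_split; apply: eq_bigr => k _; exact: scalerDl.
congr (_ + _); first by rewrite [RHS]big_ord_recl /= scale0r add0r.
by rewrite [RHS]big_ord_recr /= S0 // mulr0 scale0r addr0.
Qed.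

Lemma rStirling1_unique (R : comNzRingType) (lam : R) (r : nat)
    (S T : nat -> nat -> R) :
  is_rStirling1 lam r S -> is_rStirling1 lam r T ->
  forall n k : nat, S n k = T n k.
Proof.
have mon k : degenerate_rising lam%:P 'X k \is monic
    /\ size (degenerate_rising lam%:P 'X k) = k.+1.
  have H i : 'X + lam%:P *+ i = 'X - (- (lam *+ i))%:P :> {poly R}.
    by rewrite polyCN opprK polyCMn.
  rewrite /degenerate_rising; under eq_bigr => i _ do rewrite H.
  split; first exact: monic_prod_XsubC.
  by rewrite size_prod_XsubC /index_enum -enumT size_enum_ord.
have free (c : nat -> R) n :
    \sum_(k < n) c k *: degenerate_rising lam%:P 'X k = 0 ->
    forall k, (k < n)%N -> c k = 0.
  elim: n => // n IHn; rewrite big_ord_recr /= => sum0.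
  have cn : c n = 0.
    have [/monicP lc sz] := mon n.
    have /(congr1 (fun p : {poly R} => p`_n)) := sum0.
    rewrite coefD coefZ coef0 coef_sum big1 => [|i _]; last first.
      by rewrite coefZ nth_default ?mulr0 // (mon i).2.
    by rewrite add0r; move: lc; rewrite lead_coefE sz => ->; rewrite mulr1.
  move=> k; rewrite ltnS leq_eqVlt => /predU1P[-> //|].
  by apply: IHn; rewrite cn scale0r addr0 in sum0.
move=> [defS S0] [defT T0] n k; have [lekn|ltnk] := leqP k n; last first.
  by rewrite S0 ?T0.
apply/eqP; rewrite -subr_eq0; apply/eqP.
apply: (free (fun k => S n k - T n k) n.+1) => //.
under eq_bigr => i _ do rewrite scalerBl.
by rewrite sumrB -defS -defT subrr.
Qed.

Definition rStirling1 (R : comNzRingType) (lam : R) (r : nat) :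
  nat -> nat -> R := sval (cid (rStirling1_exists lam r)).

Lemma rStirling1P (R : comNzRingType) (lam : R) (r : nat) :
  is_rStirling1 lam r (rStirling1 lam r).
Proof. exact: svalP (cid (rStirling1_exists lam r)). Qed.

(* binomial coefficient of l over m - 1, which is 0 (and not 'C(l, m.-1) = 1)
   when m = 0 *)
Definition bin_pred (l m : nat) : nat := if m is m'.+1 then 'C(l, m') else 0.

(* Main.v *)
(** Writing <y+r>_(k+1) = (y+r) <(y+1)+r>_k, expanding the second factor in the
    basis <y+1>_(l,lam) and applying the Vandermonde identity to <y+1>_(l,lam)
    gives, since y <y>_(j,lam) = <y>_(j+1,lam) - j lam <y>_(j,lam), an expansion
    of <y+r>_(k+1) in the basis <y>_(m,lam). Its coefficients are the r-Stirling
    numbers by uniqueness. *)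
Require Import Defs.
From HB Require Import structures.
From mathcomp Require Import all_boot all_order all_algebra.
From mathcomp Require Import boolp reals.
From mathcomp Require Import ring.

Set Implicit Arguments.
Unset Strict Implicit.
Unset Printing Implicit Defensive.

Import GRing.Theory.
Local Open Scope ring_scope.

Lemma degenerate_risingS (A : comNzRingType) (lam y : A) n :
  degenerate_rising lam y n.+1 = degenerate_rising lam y n * (y + lam *+ n).
Proof. by rewrite /degenerate_rising big_ord_recr. Qed.

(** Needed for two morphisms: composition with ['X + 1] and the embedding [polyC] of constants. *)
Lemma degenerate_rising_morph (A B : comNzRingType) (f : {rmorphism A -> B})
    (lam y : A) n :
  f (degenerate_rising lam y n) = degenerate_rising (f lam) (f y) n.
Proof.
rewrite /degenerate_rising rmorph_prod.
by apply: eq_bigr => i _; rewrite rmorphD rmorphMn.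
Qed.

Lemma risingS (A : comNzRingType) (y : A) n : rising y n.+1 = y * rising (y + 1) n.
Proof.
rewrite /rising big_ord_recl addr0; congr (_ * _).
by apply: eq_bigr => i _; rewrite -addrA nat1r.
Qed.

Lemma rising_morph (A B : comNzRingType) (f : {rmorphism A -> B}) (y : A) n :
  f (rising y n) = rising (f y) n.
Proof.
rewrite /rising rmorph_prod.
by apply: eq_bigr => i _; rewrite rmorphD rmorph_nat.
Qed.

Lemma degenerate_rising_Vandermonde (A : comNzRingType) (lam x y : A) n :
  degenerate_rising lam (x + y) n =
  \sum_(j < n.+1) 'C(n, j)%:R * degenerate_rising lam x j
                    * degenerate_rising lam y (n - j).
Proof.
elim: n => [|n IHn].
  by rewrite big_ord1 /degenerate_rising !big_ord0 bin0 !mulr1.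
pose F m j := 'C(m, j)%:R * degenerate_rising lam x j
                * degenerate_rising lam y (n.+1 - j).
(* The new factor splits as x + y + n lam = (x + j lam) + (y + (n - j) lam), each part extending one
   of the two rising products. The second sum may run up to n + 1 because 'C(n, n + 1) = 0. *)
transitivity (\sum_(j < n.+1) 'C(n, j)%:R * degenerate_rising lam x j.+1
                * degenerate_rising lam y (n - j) + \sum_(j < n.+2) F n j).
  rewrite degenerate_risingS IHn mulr_suml [X in _ = _ + X]big_ord_recr /=.
  rewrite {2}/F bin_small // !mul0r addr0 -big_split /=.
  apply: eq_bigr => j _; have lejn : (j <= n)%N by rewrite -ltnS.
  rewrite /F subSn // !degenerate_risingS -[in lam *+ n](subnKC lejn) mulrnDr.
  by move: (lam *+ j) (lam *+ (n - j)) => a b; ring.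
(* With the terms j = 0 set apart, Pascal's rule merges the two sums. *)
rewrite [X in _ + X = _]big_ord_recl [RHS]big_ord_recl addrCA /=.
congr (_ + _); first by rewrite /F !bin0.
rewrite -big_split; apply: eq_bigr => j _ /=.
by rewrite /F /bump /= add1n binS natrD subSS !mulrDl addrC.
Qed.

(* The coefficient of <y>_(m,lam) in <(y+1)+r>_k. *)
Definition shift_coef (R : comNzRingType) (lam : R) (r k m : nat) : R :=
  \sum_(l < k.+1) rStirling1 lam r k l * 'C(l, m)%:R
                    * degenerate_rising lam 1 (l - m).

Lemma shift_coef_small (R : comNzRingType) (lam : R) r k m :
  (k < m)%N -> shift_coef lam r k m = 0.
Proof.
move=> ltkm; apply: big1 => l _.
by rewrite bin_small ?mulr0 ?mul0r // (leq_trans (ltn_ord l)).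
Qed.

Lemma rising_shift (R : comNzRingType) (lam : R) r k :
  rising ('X + r%:R + 1) k
  = \sum_(m < k.+1) shift_coef lam r k m *: degenerate_rising lam%:P 'X m.
Proof.
have -> : 'X + r%:R + 1 = ('X + r%:R : {poly R}) \Po ('X + 1).
  by rewrite comp_polyD comp_polyX -polyC_natr comp_polyC addrAC.
rewrite -(rising_morph (comp_poly ('X + 1))) (rStirling1P lam r).1 rmorph_sum /=.
under [RHS]eq_bigr => m _ do rewrite scaler_suml.
rewrite exchange_big /=; apply: eq_bigr => l _.
rewrite comp_polyZ (degenerate_rising_morph (comp_poly ('X + 1))) /=.
rewrite comp_polyC comp_polyX degenerate_rising_Vandermonde scaler_sumr.
(* The Vandermonde sum stops at j = l; it is padded up to k with terms in which 'C(l, j) = 0. *)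
rewrite (big_ord_widen k.+1 (fun j => rStirling1 lam r k l *:
  ('C(l, j)%:R * degenerate_rising lam%:P 'X j
     * degenerate_rising lam%:P 1 (l - j)))) // big_mkcond /=.
apply: eq_bigr => j _; case: ltnP => [_|ltlj]; last first.
  by rewrite bin_small // mulr0 mul0r scale0r.
rewrite -(degenerate_rising_morph polyC) /= -!mul_polyC !polyCM polyC_natr.
by ring.
Qed.

Lemma rStirling1_rec (R : comNzRingType) (lam : R) r k m :
  rStirling1 lam r k.+1 m
  = (if m is m'.+1 then shift_coef lam r k m' else 0)
    + (r%:R - m%:R * lam) * shift_coef lam r k m.
Proof.
pose c k m := (if m is m'.+1 then shift_coef lam r k m' else 0)
    + (r%:R - m%:R * lam) * shift_coef lam r k m.
(* The recurrence only yields rows n + 1, so row 0 is read off from the empty product. *)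
pose T n m := if n is k.+1 then c k m else (m == 0)%:R.
suff TP : is_rStirling1 lam r T.
  exact: (rStirling1_unique (rStirling1P lam r) TP k.+1 m).
split=> [[|n]|[|n] [|j] // ltnj]; last first.
- by rewrite /= /c !shift_coef_small ?mulr0 ?addr0 // ltnW.
- rewrite risingS (rising_shift lam) mulr_sumr.
  rewrite /= /c; under [RHS]eq_bigr => i _ do rewrite scalerDl.
  (* Both sums are cut to n + 1 terms: the first loses its zero term m = 0 and is reindexed, the
     second loses m = n + 1, where [shift_coef] vanishes. *)
  rewrite big_split /= [X in _ = X + _]big_ord_recl scale0r add0r.
  rewrite [X in _ = _ + X]big_ord_recr /=.
  rewrite [shift_coef _ _ _ n.+1]shift_coef_small // mulr0 scale0r addr0.
  rewrite -big_split /=; apply: eq_bigr => i _.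
  rewrite /bump /= add1n degenerate_risingS -!mul_polyC !rmorphM /= rmorphB /=.
  by rewrite rmorphM /= !polyC_natr -mulr_natl; ring.
- by rewrite /rising /degenerate_rising big_ord1 !big_ord0 /= scale1r.
Qed.

Lemma shift_coefE (R : comNzRingType) (lam : R) r k m : (m <= k.+1)%N ->
  shift_coef lam r k m
  = \sum_(m <= l < k.+1) rStirling1 lam r k l * 'C(l, m)%:R
                           * degenerate_rising lam 1 (l - m).
Proof.
move=> lemk; rewrite /shift_coef.
rewrite -(big_mkord xpredT (fun l => rStirling1 lam r k l * 'C(l, m)%:R
                           * degenerate_rising lam 1 (l - m))).
rewrite (big_cat_nat (leq0n m) lemk) //= big_nat big1 ?add0r // => l /andP[_ ltlm].
by rewrite bin_small // mulr0 mul0r.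
Qed.

Theorem theorem10 (R : realType) (lam : R) (r m k : nat) (hmk : (m <= k)%N) :
  (-1) ^+ (k - m + 1) * rStirling1 lam r (k + 1) m
  = \sum_(m.-1 <= l < k.+1)
      rStirling1 lam r k l * (-1) ^+ (k - m + 1) * (bin_pred l m)%:R
        * degenerate_rising lam 1 (l + 1 - m)
    + (m%:R * lam - r%:R) *
      \sum_(m <= l < k.+1)
        rStirling1 lam r k l * (-1) ^+ (k - m) * 'C(l, m)%:R
          * degenerate_rising lam 1 (l - m).
Proof.
rewrite [(k + 1)%N]addn1 rStirling1_rec mulrDr; congr (_ + _).
  (* For m = 0 both sides vanish, by the convention built into [bin_pred]. *)
  case: m hmk => [|m] hmk /=.
    by rewrite mulr0 big1 // => l _; rewrite mulr0 mul0r.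
  rewrite shift_coefE ?mulr_sumr; last by rewrite ltnW // ltnW.
  by apply: eq_bigr => l _; rewrite [(l + 1)%N]addn1 subSS; ring.
(* The extra sign in (-1)^(k - m + 1) turns r - m lam into m lam - r. *)
rewrite shift_coefE ?(leqW hmk) // addn1 exprS !mulr_sumr.
by apply: eq_bigr => l _; ring.
Qed.
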